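(* Let $f\in\mathcal{S}(\Omega)$ and let $x\in\Omega\setminus\mathbb{R}$. (1) If $f'_s(x)=0$, then one of the following holds: (a) $\mathbb{S}_x$ is included in $V(f)$, $V(f^c)$, $V(N(f))$ and $V(N(f^c))$; (b) $\mathbb{S}_x$ intersects neither $V(f)$ nor $V(f^c)$; moreover it intersects neither $V(N(f))$ nor $V(N(f^c))$, unless $A$ is singular and $f^\circ_s(x)$ (the constant value of $f$ on $\mathbb{S}_x$) or $f^\circ_s(x)^c$ is a nonzero element of norm $0$. (2) If $f'_s(x)$ is a right zero divisor, then one of the following holds: (a) $\mathbb{S}_x$ intersects $V(f)$ at at least one point $y$, and $\mathbb{S}_x\cap V(f)$ is the set of all $y'\in\mathbb{S}_x$ such that $(\mathrm{im}(y')-\mathrm{im}(y))f'_s(x)=0$. Moreover $y^c\notin V(f)$ and $y^c\in V(N(f^c))$. The equality $(f'_s(x),f'_s(x)^c,y)=0$ is equivalent to $\mathbb{S}_x\subseteq V(N(f^c))$ and to $y\in V(N(f))$; if it holds, then $\mathbb{S}_x\subseteq V(N(f))$ if, and only if, $[n(f'_s(x)),y]=0$; (b) $\mathbb{S}_x$ does not intersect $V(f)$. (3) If $f'_s(x)$ is neither $0$ nor a right zero divisor, then one of the following holds: (a) $\mathbb{S}_x$ intersects $V(f)$ at exactly one point $y$, and $y^c\in V(N(f^c))$. If $f'_s(x)$ is invertible, then $y=\mathrm{re}(x)-f^\circ_s(x)f'_s(x)^{-1}$. The equality $(f'_s(x),f'_s(x)^c,y)=0$ is equivalent to $\mathbb{S}_x\subseteq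 V(N(f^c))$ and to $y\in V(N(f))$; if it holds, then $\mathbb{S}_x\subseteq V(N(f))$ if, and only if, $[n(f'_s(x)),y]=0$. In particular, if $f'_s(x)\in C_A\setminus\{0\}$, then $\mathbb{S}_x$ is included both in $V(N(f))$ and in $V(N(f^c))$ and $\mathbb{S}_x\cap V(f^c)=\{f'_s(x)^{-1}y^cf'_s(x)\}$; (b) $\mathbb{S}_x$ does not intersect $V(f)$. If $f'_s(x)\in C_A\setminus\{0\}$, then $\mathbb{S}_x$ does not intersect $V(f^c)$ and it cannot be included both in $V(N(f))$ and in $V(N(f^c))$. If, moreover, $f^\circ_s(x)\in C_A\setminus\{0\}$ (or if $A$ is compatible), then $\mathbb{S}_x$ is included neither in $V(N(f))$ nor in $V(N(f^c))$. Finally, if $x\in\Omega\cap\mathbb{R}$, then either $x$ belongs to $V(f)$, $V(f^c)$, $V(N(f))$ and $V(N(f^c))$; or $x$ belongs to neither $V(f)$ nor $V(f^c)$, and it belongs to neither $V(N(f))$ nor $V(N(f^c))$ unless $A$ is singular and $f(x)$ or $f(x)^c$ is a nonzero element of norm $0$.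
   Context: Let $A$ be a finite-dimensional real algebra with unit $1$ ($\mathbb{R}$ identified with $\mathbb{R}1$) which is alternative (the associator $(x,y,z)=(xy)z-x(yz)$ is alternating), with a $^*$-involution $x\mapsto x^c$ (real linear, $(x^c)^c=x$, $(xy)^c=y^cx^c$, $r^c=r$ for $r\in\mathbb{R}$). Let $t(x)=x+x^c$, $n(x)=xx^c$; $A$ is singular if some nonzero $x$ has $n(x)=0$, and compatible if $t$ takes values in the nucleus $\{r:(r,a,b)=0\ \forall a,b\}$. The center is the set of $r$ in the nucleus with $ra=ar$ for all $a$; $C_A=\{0\}\cup\{a\in A: n(a),n(a^c)$ invertible elements of the center$\}$. A nonzero $a\in A$ is a right zero divisor if $ba=0$ for some nonzero $b\in A$. $[a,b]=ab-ba$. Let $\mathbb{S}_A=\{J\in A:t(J)=0,n(J)=1\}$ (assumed non-empty), $Q_A=\mathbb{R}\cup\{x\in A:t(x),n(x)\in\mathbb{R},\ 4n(x)>t(x)^2\}$; every $x\in Q_A$ is $\alpha+\beta J$ with $\alpha,\beta\in\mathbb{R}$, $J\in\mathbb{S}_A$, $x^c=\alpha-\beta J$, $\mathrm{re}(x)=t(x)/2$, $\mathrm{im}(x)=x-\mathrm{re}(x)$, and $\mathbb{S}_x=\{\alpha+\beta I:I\in\mathbb{S}_A\}$. Let $D\subseteq\mathbb{C}$ be non-empty and invariant under complex conjugation and $\Omega=\{\alpha+\beta J:\alpha+i\beta\in D,\ J\in\mathbb{S}_A\}$. Let $A_{\mathbb{C}}=\{a+\imath b:a,b\in A\}$ with product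 $(a+\imath b)(a'+\imath b')=aa'-bb'+\imath(ab'+ba')$, conjugation $\overline{a+\imath b}=a-\imath b$, involution $(a+\imath b)^c=a^c+\imath b^c$. A stem function is $F=F_1+\imath F_2:D\to A_{\mathbb{C}}$ with $F(\bar z)=\overline{F(z)}$; it induces the slice function $f=\mathcal{I}(F)$, $f(\alpha+\beta J)=F_1(\alpha+i\beta)+JF_2(\alpha+i\beta)$. $\mathcal{S}(\Omega)$ is the set of slice functions, with slice product $f\cdot g=\mathcal{I}(FG)$, conjugate $f^c=\mathcal{I}(F^c)$, $F^c(z)=F(z)^c$, and normal function $N(f)=f\cdot f^c$. $V(h)=\{x:h(x)=0\}$. Spherical value $f^\circ_s(x)=\frac12(f(x)+f(x^c))$ and spherical derivative $f'_s(x)=\frac12\mathrm{im}(x)^{-1}(f(x)-f(x^c))$ for $x\in\Omega\setminus\mathbb{R}$. *)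

(* Defs.v *)
From HB Require Import structures.
From mathcomp Require Import all_boot all_order all_algebra.
From mathcomp Require Import boolp classical_sets reals.

Set Implicit Arguments.
Unset Strict Implicit.
Unset Printing Implicit Defensive.

Import Order.TTheory GRing.Theory Num.Theory.
Local Open Scope ring_scope.
Local Open Scope classical_set_scope.

Definition assoc_of (V : zmodType) (m : V -> V -> V) (x y z : V) : V :=
  m (m x y) z - m x (m y z).

(* A finite-dimensional real algebra (carrier: a vectType over R, i.e. a
   finite-dimensional R-vector space) with a bilinear, not necessarily
   associative, product, a unit 1 (<> 0, so that R embeds as R1), which is
   alternative (the associator is an alternating trilinear map, i.e. it
   vanishes whenever two of its arguments coincide), together with a
   *-involution. *)
Record altStarAlg (R : realType) (A : vectType R) := AltStarAlg {
  amul : A -> A -> A;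
  aone : A;
  aconj : A -> A;
  amulDl : forall (a : R) (x y z : A), amul (a *: x + y) z = a *: amul x z + amul y z;
  amulDr : forall (a : R) (x y z : A), amul z (a *: x + y) = a *: amul z x + amul z y;
  amul1l : forall x, amul aone x = x;
  amul1r : forall x, amul x aone = x;
  aone_neq0 : aone != 0;
  alternative : forall x y : A,
      assoc_of amul x x y = 0 /\ assoc_of amul x y x = 0 /\ assoc_of amul y x x = 0;
  aconj_lin : forall (a : R) (x y : A), aconj (a *: x + y) = a *: aconj x + aconj y;
  aconjK : forall x, aconj (aconj x) = x;
  aconjM : forall x y, aconj (amul x y) = amul (aconj y) (aconj x);
  aconj_real : forall r : R, aconj (r *: aone) = r *: aone
}.

Section Defs.
Variables (R : realType) (A : vectType R) (S : altStarAlg A).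

Local Notation "x ** y" := (amul S x y) (at level 40, left associativity).
Local Notation one := (aone S).
Local Notation cj := (aconj S).

Definition isReal (x : A) : Prop := exists r : R, x = r *: one.
Definition atr (x : A) : A := x + cj x.
Definition anrm (x : A) : A := x ** cj x.
Definition aassoc (x y z : A) : A := assoc_of (amul S) x y z.
Definition acomm (x y : A) : A := x ** y - y ** x.
Definition anucleus (r : A) : Prop := forall a b : A, aassoc r a b = 0.
Definition acenter (r : A) : Prop := anucleus r /\ forall a : A, r ** a = a ** r.
Definition ainvertible (x : A) : Prop := exists y, x ** y = one /\ y ** x = one.
Definition ainv (x : A) : A := xget 0 [set y | x ** y = one /\ y ** x = one].
Definition CA (a : A) : Prop :=
  a = 0 \/ (acenter (anrm a) /\ ainvertible (anrm a) /\
            acenter (anrm (cj a)) /\ ainvertible (anrm (cj a))).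
Definition asingular : Prop := exists x : A, x != 0 /\ anrm x = 0.
Definition acompatible : Prop := forall x : A, anucleus (atr x).
Definition right_zero_divisor (a : A) : Prop :=
  a != 0 /\ exists b : A, b != 0 /\ b ** a = 0.
Definition null_nz (a : A) : Prop := a != 0 /\ anrm a = 0.
Definition SA (J : A) : Prop := atr J = 0 /\ anrm J = one.
Definition are (x : A) : A := (2%:R)^-1 *: atr x.
Definition aim (x : A) : A := x - are x.
Definition sphere (x : A) : set A :=
  [set y | exists (a b : R) (J I : A), SA J /\ SA I /\
     x = a *: one + b *: J /\ y = a *: one + b *: I].

(* D is a subset of C, complex numbers alpha + i beta encoded as (alpha, beta) *)
Definition Omega (D : set (R * R)) : set A :=
  [set y | exists (a b : R) (J : A), D (a, b) /\ SA J /\ y = a *: one + b *: J].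

(* Stem functions D -> A_C, A_C encoded as A * A (u + i v ~ (u, v)). *)
Definition is_stem (D : set (R * R)) (F : R * R -> A * A) : Prop :=
  forall a b : R, D (a, b) -> F (a, - b) = ((F (a, b)).1, - (F (a, b)).2).

(* The slice function I(F) induced by a stem function; its value at
   y = alpha + beta J in Omega is F1(alpha + i beta) + J F2(alpha + i beta)
   (well defined by the stem condition); outside Omega it is irrelevant. *)
Definition sliceI (D : set (R * R)) (F : R * R -> A * A) : A -> A :=
  fun y => xget 0 [set v | exists (a b : R) (J : A), D (a, b) /\ SA J /\
                   y = a *: one + b *: J /\ v = (F (a, b)).1 + J ** (F (a, b)).2].

Definition stem_mul (F G : R * R -> A * A) : R * R -> A * A :=
  fun z => ((F z).1 ** (G z).1 - (F z).2 ** (G z).2,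
            (F z).1 ** (G z).2 + (F z).2 ** (G z).1).
Definition stem_conj (F : R * R -> A * A) : R * R -> A * A :=
  fun z => (cj (F z).1, cj (F z).2).
Definition stem_normal (F : R * R -> A * A) : R * R -> A * A :=
  stem_mul F (stem_conj F).

Definition VZ (D : set (R * R)) (h : A -> A) : set A :=
  [set y | Omega D y /\ h y = 0].

Definition sph_val (h : A -> A) (x : A) : A := (2%:R)^-1 *: (h x + h (cj x)).
Definition sph_der (h : A -> A) (x : A) : A :=
  (2%:R)^-1 *: (ainv (aim x) ** (h x - h (cj x))).

End Defs.

(* Main.v *)
Require Import Defs.
From HB Require Import structures.
From mathcomp Require Import all_boot all_order all_algebra.
From mathcomp Require Import boolp classical_sets reals.
From mathcomp Require Import ring lra.

Import Order.TTheory GRing.Theory Num.Theory.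
Local Open Scope ring_scope.
Local Open Scope classical_set_scope.

(** On the sphere of [alpha + beta J] write [f (alpha + beta I) = a + I b], so that
    [a] is the spherical value and [b = beta f'_s]. At a zero [a = - I b] one has,
    with [E = (b^c, I, b)],
      [N(f^c) (alpha + beta K) = (I + K) E] and
      [N(f) (alpha + beta K) = (K - I) [n(b), I] - 2 K E],
    by the Moufang identities, and [beta (f'_s, f'_s^c, y) = E] up to rotation of the
    associator: this gives every equivalence in (2) and (3). If [b] lies in [C_A],
    then [n(b) = n(b^c)] is central with inverse [m], [E] vanishes, and whenever
    [N(f)] vanishes on the sphere, [I = - m (a b^c)] has trace zero and satisfies
    [I^2 = -1], so [alpha + beta I] is a zero of [f]. Applied to [f] and [f^c], this
    settles the statements about [C_A]. *)

(** Coordinates in a basis are linear forms, so linear forms separate points. Vector identities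
    thereby reduce to real ones. *)
Lemma scalar_ext (R : realType) (A : vectType R) (u v : A) :
  (forall phi : {scalar A}, phi u = phi v) -> u = v.
Proof.
move=> uv; rewrite (coord_vbasis (memvf u)) (coord_vbasis (memvf v)).
by apply: eq_bigr => i _; rewrite (uv (coord (vbasis fullv) i)).
Qed.

(* Linear consequences of the vector equations in the context are decided
   by [lra] after applying an arbitrary linear form. *)
Ltac vlin :=
  unfold aassoc, assoc_of, acomm, anrm, atr in *;
  apply: scalar_ext; let phi := fresh "phi" in intro phi;
  repeat match goal with
  | H : @eq _ ?u ?v |- _ => move: (congr1 phi H); clear H
  end;
  rewrite ?(linearB, linearD, linearN, linearZ, linear0) /=; intros; lra.

(** * Calculus in an alternative algebra with involution, up to the Moufang identities *)

Section Alternative.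
Context {R : realType} {A : vectType R} (S : altStarAlg A).
Local Notation "x ** y" := (amul S x y) (at level 40, left associativity).
Local Notation one := (aone S).
Local Notation cj := (aconj S).
Implicit Types x y z w : A.

Lemma amulDl' x y z : (x + y) ** z = x ** z + y ** z.
Proof. by have := amulDl S 1 x y z; rewrite !scale1r. Qed.
Lemma amulDr' x y z : z ** (x + y) = z ** x + z ** y.
Proof. by have := amulDr S 1 x y z; rewrite !scale1r. Qed.
Lemma amul0l z : 0 ** z = 0.
Proof. by apply: (addIr (0 ** z)); rewrite -amulDl' !add0r. Qed.
Lemma amul0r z : z ** 0 = 0.
Proof. by apply: (addIr (z ** 0)); rewrite -amulDr' !add0r. Qed.
Lemma amulZl a x z : (a *: x) ** z = a *: (x ** z).
Proof. by have := amulDl S a x 0 z; rewrite !addr0 amul0l addr0. Qed.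
Lemma amulZr a x z : z ** (a *: x) = a *: (z ** x).
Proof. by have := amulDr S a x 0 z; rewrite !addr0 amul0r addr0. Qed.
Lemma amulNl x z : (- x) ** z = - (x ** z).
Proof. by rewrite -scaleN1r amulZl scaleN1r. Qed.
Lemma amulNr x z : z ** (- x) = - (z ** x).
Proof. by rewrite -scaleN1r amulZr scaleN1r. Qed.

Lemma aconjD x y : cj (x + y) = cj x + cj y.
Proof. by have := aconj_lin S 1 x y; rewrite !scale1r. Qed.
Lemma aconj0 : cj 0 = 0.
Proof. by apply: (addIr (cj 0)); rewrite -aconjD !add0r. Qed.
Lemma aconjZ a x : cj (a *: x) = a *: cj x.
Proof. by have := aconj_lin S a x 0; rewrite !addr0 aconj0 addr0. Qed.
Lemma aconjN x : cj (- x) = - cj x.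
Proof. by rewrite -scaleN1r aconjZ scaleN1r. Qed.
Lemma aconj1 : cj one = one.
Proof. by have := aconj_real S 1; rewrite !scale1r. Qed.
Lemma aconj_eq0 x : (cj x = 0) <-> (x = 0).
Proof. by split=> [h|->]; rewrite ?aconj0 // -(aconjK S x) h aconj0. Qed.

Definition mulE := (amulDl', amulDr', amulNl, amulNr, amulZl, amulZr,
  amul0l, amul0r, amul1l, amul1r).
Definition conjE := (aconjD, aconjN, aconjZ, aconjM, aconjK, aconj1, aconj0).

Lemma amul_altl x y : x ** (x ** y) = (x ** x) ** y.
Proof. by case: (alternative S x y) => /eqP; rewrite subr_eq0 => /eqP. Qed.
Lemma amul_flex x y : (x ** y) ** x = x ** (y ** x).
Proof. by case: (alternative S x y) => _ [/eqP]; rewrite subr_eq0 => /eqP. Qed.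
Lemma amul_altr x y : (y ** x) ** x = y ** (x ** x).
Proof. by case: (alternative S x y) => _ [_ /eqP]; rewrite subr_eq0 => /eqP. Qed.

Lemma aassocCl x y z : aassoc S y x z = - aassoc S x y z.
Proof.
have h := amul_altl (x + y) z; have h1 := amul_altl x z.
have h2 := amul_altl y z; rewrite !mulE in h; vlin.
Qed.
Lemma aassocCr x y z : aassoc S x z y = - aassoc S x y z.
Proof.
have h := amul_altr (y + z) x; have h1 := amul_altr y x.
have h2 := amul_altr z x; rewrite !mulE in h; vlin.
Qed.
Lemma aassoc_rot x y z : aassoc S x y z = aassoc S y z x.
Proof. by rewrite aassocCl aassocCr opprK. Qed.

(** Valid for any bilinear product: after expansion the bracketings of [w x y z] cancel in pairs. *)
Lemma teichmuller w x y z :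
  aassoc S (w ** x) y z - aassoc S w (x ** y) z + aassoc S w x (y ** z) =
  w ** aassoc S x y z + aassoc S w x y ** z.
Proof. by rewrite /aassoc /assoc_of !mulE; vlin. Qed.

(* [L_x L_y + L_y L_x = L_(xy + yx)] *)
Lemma amul_altl_lin x y z :
  x ** (y ** z) + y ** (x ** z) = (x ** y) ** z + (y ** x) ** z.
Proof. have h := aassocCl x y z; vlin. Qed.

(* Apply the linearised identity to [x] and [xy + yx]. *)
Lemma moufang_left x y z : ((x ** y) ** x) ** z = x ** (y ** (x ** z)).
Proof.
have h1 := amul_altl_lin x (x ** y + y ** x) z.
have h2 := amul_altl_lin (x ** x) y z.
have h3 := congr1 (fun w => x ** w) (amul_altl_lin x y z).
have h4 := amul_altl_lin x y (x ** z).
have h5 := congr1 (fun w => w ** z) (amul_altl x y).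
have h6 := congr1 (fun w => w ** z) (amul_altr x y).
have h7 := congr1 (fun w => w ** z) (amul_flex x y).
have h8 := congr1 (fun w => y ** w) (amul_altl x z).
have h9 := amul_altl x (y ** z).
rewrite !mulE in h1 h2 h3 h4 h5 h6 h7 h8 h9 *; vlin.
Qed.

(** The Moufang identity in associator form: it lets a repeated factor leave the associator. *)
Lemma aassoc_mulr x y z : aassoc S x y (z ** x) = x ** aassoc S x y z.
Proof.
have h1 := teichmuller x z x y.
have h2 := moufang_left x z y.
have h3 := amul_flex x z.
have h4 := aassocCr x (z ** x) y.
have h5 := congr1 (fun w => x ** w) (aassoc_rot x y z).
have h6 := congr1 (fun w => x ** w) (aassoc_rot y z x).
have h7 := congr1 (fun w => x ** w) (aassocCl z x y).
have h8 := congr1 (fun w => w ** y) h3.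
rewrite /aassoc /assoc_of !mulE in h1 h2 h3 h4 h5 h6 h7 h8 *; vlin.
Qed.

(** Expand [aassoc_mulr] with (x, y, z) rotated to (y, z, x): the terms x (y (z x)) cancel, and
    flexibility finishes. *)
Lemma moufang_middle x y z : (x ** y) ** (z ** x) = (x ** (y ** z)) ** x.
Proof.
have h1 := aassoc_mulr x y z.
have h2 := congr1 (fun w => x ** w) (aassoc_rot x y z).
have h3 := amul_flex x (y ** z).
rewrite /aassoc /assoc_of !mulE in h1 h2 h3 *; vlin.
Qed.

(* With [P = L_y L_x] and [Q = L_x L_y], [P + Q = 2] and both are idempotent
   by the Moufang identity, so that [P = 1]. *)
Lemma amulK x y z : x ** y = one -> y ** x = one -> x ** (y ** z) = z.
Proof.
move=> xy yx.
have h1 u := amul_altl_lin x y u.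
have h2 := moufang_left x y (y ** z).
have h3 := moufang_left y x (x ** z).
have h4 := h1 z; have h5 := congr1 (fun w => y ** (x ** w)) (h1 z).
have h6 := h1 (x ** (y ** z)).
clear h1; rewrite xy yx !mulE in h2 h3 h4 h5 h6 *; vlin.
Qed.

(** The involution reverses products, so this is [amulK] for the conjugates. *)
Lemma amulVK x y z : x ** y = one -> y ** x = one -> (z ** x) ** y = z.
Proof.
move=> xy yx; apply: (can_inj (aconjK S)); rewrite !aconjM.
by apply: amulK; rewrite -aconjM ?xy ?yx aconj1.
Qed.

Lemma ainv_unique x y : x ** y = one -> y ** x = one -> ainv S x = y.
Proof.
move=> xy yx; rewrite /ainv; case: xgetP => [z _ [xz zx]|/(_ y)]; last first.
  by case; split.
by rewrite -(amulK y x z) // xz amul1r.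
Qed.

(** * The center and the set [CA] *)

Lemma acenterA r x y : acenter S r -> (r ** x) ** y = r ** (x ** y).
Proof. by case=> /(_ x y)/eqP; rewrite subr_eq0 => /eqP. Qed.

(** The nucleus constrains only the first slot of the associator; alternation carries [r] to the
    middle slot. *)
Lemma acenterCA r x y : acenter S r -> x ** (r ** y) = r ** (x ** y).
Proof.
move=> cr; rewrite -(acenterA r) // (proj2 cr x).
have h := aassocCl x r y; have h1 := proj1 cr x y; vlin.
Qed.

(** Left multiplication by [r] is injective, so each condition on [m] may be tested after
    multiplying by [r]. *)
Lemma acenter_inv r m : acenter S r -> r ** m = one -> acenter S m.
Proof.
move=> cr rm; have mr : m ** r = one by rewrite -(proj2 cr).
have inj u : r ** u = 0 -> u = 0.
  by move=> ru; rewrite -(amulK m r u) // ru amul0r.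
split=> [x y|x]; last first.
  apply/eqP; rewrite -subr_eq0; apply/eqP/inj; rewrite mulE amulNr.
  by rewrite -acenterA // rm amul1l -acenterCA // rm amul1r subrr.
apply: inj; rewrite /aassoc /assoc_of mulE amulNr -!(acenterA r) //.
by rewrite rm !amul1l subrr.
Qed.

(** The two norms of b agree: d = n(b^c) - n(b) is central and d b = 0, so d n(b^c) = b^c (d b) = 0,
    and n(b^c) is invertible. *)
Lemma CA_norm b : CA S b -> b <> 0 -> exists n m,
  [/\ acenter S n, acenter S m, n ** m = one, b ** cj b = n & cj b ** b = n].
Proof.
case=> // -[+ [+ [+ +]]] nb; rewrite /anrm aconjK.
set n := b ** cj b; set n' := cj b ** b => cn [m [nm mn]] cn' [m' [nm' mn']].
exists n, m; split=> //; first exact: acenter_inv nm.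
apply/eqP; rewrite -/n' -subr_eq0; apply/eqP.
have e : b ** (n' - n) = 0.
  by rewrite mulE amulNr -amul_flex -/n (proj2 cn) subrr.
have e' : (n' - n) ** b = 0.
  by rewrite -e !mulE (proj2 cn' b) (proj2 cn b).
have cd : acenter S (n' - n).
  split=> [x y|x].
    have h1 := proj1 cn x y; have h2 := proj1 cn' x y.
    by rewrite /aassoc /assoc_of !mulE in h1 h2 *; vlin.
  have h1 := proj2 cn x; have h2 := proj2 cn' x.
  by rewrite /aassoc /assoc_of !mulE in h1 h2 *; vlin.
have e2 : (n' - n) ** n' = 0.
  by rewrite -acenterCA // e' amul0r.
by rewrite -(amulVK _ _ (n' - n) nm' mn') e2 amul0l.
Qed.

(** Since m b^c inverts b, left cancellation gives b^c (b x) = n x = (b^c b) x; rotate the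
    associator. *)
Lemma CA_assoc b x : CA S b -> b <> 0 -> aassoc S x (cj b) b = 0.
Proof.
move=> Cb b0; have [n [m [cn cm nm bc cb]]] := CA_norm b Cb b0.
have mn : m ** n = one by rewrite -(proj2 cn).
rewrite aassoc_rot /aassoc /assoc_of cb.
have h : (m ** cj b) ** (b ** x) = x.
  apply: amulK; first by rewrite acenterA // cb.
  by rewrite acenterCA // bc.
rewrite acenterA // in h.
by rewrite -[cj b ** (b ** x)](amulK n m) // h subrr.
Qed.

Lemma CA_invertible b : CA S b -> b <> 0 -> ainvertible S b.
Proof.
move=> Cb b0; have [n [m [cn cm nm bc cb]]] := CA_norm b Cb b0.
exists (m ** cj b); rewrite acenterCA // acenterA // bc cb.
by rewrite -(proj2 cn).
Qed.

Lemma CA_aconj b : CA S b -> CA S (cj b).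
Proof.
case=> [->|[c1 [i1 [c2 i2]]]]; first by left; rewrite aconj0.
by right; rewrite aconjK.
Qed.

(** Transfers membership from f'_s to b = beta f'_s; the norms are multiplied by r^2. *)
Lemma CA_scale r b : r != 0 -> CA S b -> CA S (r *: b).
Proof.
move=> r0 [->|[c1 [i1 [c2 i2]]]]; first by left; rewrite scaler0.
have cen n : acenter S n -> acenter S ((r * r) *: n).
  case=> h1 h2; split=> [x y|x]; last by rewrite !mulE h2.
  have := h1 x y; rewrite /aassoc /assoc_of !mulE => h.
  by rewrite -scalerBr h scaler0.
have inv n : ainvertible S n -> ainvertible S ((r * r) *: n).
  case=> m [nm mn]; exists ((r * r)^-1 *: m).
  by rewrite !mulE nm mn !scalerA ?mulVf ?mulfV ?scale1r // mulf_neq0.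
have e c : anrm S (r *: c) = (r * r) *: anrm S c.
  by rewrite /anrm aconjZ !mulE scalerA.
by right; rewrite aconjZ !e; do !split; auto; apply cen.
Qed.

(** * Imaginary units, and the normal function on a sphere *)

Lemma SA_conj J : SA S J -> cj J = - J.
Proof. by case=> /eqP; rewrite /atr addrC addr_eq0 => /eqP. Qed.
Lemma SA_sqr J : SA S J -> J ** J = - one.
Proof.
move=> sJ; case: (sJ) => _; rewrite /anrm (SA_conj _ sJ) amulNr => <-.
by rewrite opprK.
Qed.
Lemma SA_intro J : cj J = - J -> J ** J = - one -> SA S J.
Proof. by move=> cJ JJ; rewrite /SA /atr /anrm cJ subrr amulNr JJ opprK. Qed.
Lemma SA_opp J : SA S J -> SA S (- J).
Proof.
move=> sJ; apply: SA_intro; first by rewrite aconjN SA_conj.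
by rewrite amulNl amulNr opprK SA_sqr.
Qed.
Lemma SA_mulK J x : SA S J -> J ** (J ** x) = - x.
Proof. by move=> sJ; rewrite amul_altl SA_sqr // amulNl amul1l. Qed.
Lemma SA_mul_eq0 J x : SA S J -> J ** x = 0 -> x = 0.
Proof.
by move=> sJ Jx; rewrite -[x]opprK -(SA_mulK _ x sJ) Jx amul0r oppr0.
Qed.
Lemma double_eq0 x : x + x = 0 -> x = 0.
Proof. by move=> h; vlin. Qed.

(** As (c I) I = - c, the left side is the associator (c I, I, b); rotate it to (I, b, c I) and
    extract I by [aassoc_mulr]. *)
Lemma SA_assoc I b c : SA S I ->
  - ((c ** I) ** (I ** b)) - c ** b = I ** aassoc S c I b.
Proof.
move=> sI.
have h1 := aassoc_mulr I b c.
have h2 := teichmuller c I I b.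
have h3 := amul_altr I c; have h4 := amul_altl I b.
have h5 := aassoc_rot (c ** I) I b.
have h6 := congr1 (fun w => I ** w) (aassoc_rot c I b).
have h7 := congr1 (fun w => c ** w) h4.
have h8 := congr1 (fun w => w ** b) h3.
rewrite /aassoc /assoc_of ?SA_sqr // !mulE ?SA_mulK // in h1 h2 h3 h4 h5 h6 h7 h8 *.
vlin.
Qed.

(* The value at [alpha + beta I] of the normal function [N(f)] when the stem
   function of [f] takes the value [a + i b] at [alpha + i beta]. *)
Definition normal_val a b I :=
  a ** cj a - b ** cj b + I ** (a ** cj b + b ** cj a).

(** Here a^c = b^c I, so a^c b + b^c a is the associator itself, and [SA_assoc] treats the
    difference of norms. *)
Lemma normal_conj_zero I J b : SA S I ->
  normal_val (cj (- (I ** b))) (cj b) J = (I + J) ** aassoc S (cj b) I b.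
Proof.
move=> sI; rewrite /normal_val !conjE (SA_conj I) // !mulE.
have h := SA_assoc I b (cj b) sI.
rewrite /aassoc /assoc_of ?mulE in h *; vlin.
Qed.

(** Middle Moufang gives n(a) = - (I n(b)) I, and a b^c + b a^c equals [n(b), I] minus two rotations
    of the associator. *)
Lemma normal_zero I J b : SA S I -> normal_val (- (I ** b)) b J =
  (J - I) ** acomm S (b ** cj b) I - (J ** aassoc S (cj b) I b) *+ 2.
Proof.
move=> sI; rewrite /normal_val !conjE (SA_conj I) // !mulE.
have h1 := moufang_middle I b (cj b).
have h2 := SA_mulK I (b ** cj b) sI.
have h3 := amul_flex I (b ** cj b).
have h4 := congr1 (fun w => J ** w) (aassoc_rot (cj b) I b).
have h5 := congr1 (fun w => J ** w) (aassoc_rot I b (cj b)).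
rewrite mulr2n /acomm /aassoc /assoc_of ?mulE in h1 h2 h3 h4 h5 *; vlin.
Qed.

(* The zero is [I = - a b^-1]; middle Moufang turns [n(a) = n(b)] into
   [I^2 = -1]. *)
Lemma normal_val_zero a b : CA S b -> b <> 0 -> (exists J, SA S J) ->
  (forall I, SA S I -> normal_val a b I = 0) ->
  exists2 I, SA S I & a + I ** b = 0.
Proof.
move=> Cb b0 [J sJ] N0.
have [n [m [cn cm nm bc cb]]] := CA_norm b Cb b0.
have mn : m ** n = one by rewrite -(proj2 cn).
(* The values at J and -J separate the two parts: n(a) = n(b), and the trace part vanishes. *)
have h1 := N0 J sJ; have h2 := N0 _ (SA_opp _ sJ); clear N0.
rewrite /normal_val amulNl in h1 h2.
have na : a ** cj a = n by rewrite -bc; vlin.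
have t0 : a ** cj b + b ** cj a = 0 by apply: (SA_mul_eq0 J) => //; vlin.
clear h1 h2.
have cjn : cj n = n by rewrite -bc !conjE.
have cjm : cj m = m.
  by rewrite -(amulK m n (cj m)) // -{1}cjn -aconjM mn aconj1 amul1r.
(* The inverse of b is m b^c, so this is - a b^-1. *)
pose I := - (m ** (a ** cj b)).
have Ib : I ** b = - a.
  rewrite /I amulNl acenterA //.
  have -> : (a ** cj b) ** b = n ** a.
    have /eqP := CA_assoc b a Cb b0.
    by rewrite /aassoc /assoc_of cb -(proj2 cn) subr_eq0 => /eqP.
  by rewrite amulK.
have cI : cj I = - I.
  rewrite /I !conjE cjm -(proj2 cm) opprK.
  have -> : b ** cj a = - (a ** cj b) by vlin.
  by rewrite amulNr opprK.
clearbody I; exists I; last by rewrite Ib subrr.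
apply: SA_intro => //.
have ca : cj a = cj b ** I.
  by rewrite -[a]opprK -Ib !conjE cI amulNr opprK.
have h : n ** (I ** I) = - n.
  rewrite -{2}na ca -[in RHS](opprK a) -Ib amulNl opprK.
  by rewrite moufang_middle bc -(proj2 cn) acenterA.
by rewrite -(amulK m n (I ** I)) // h amulNr mn.
Qed.

(** At a zero of f the associator vanishes because b is in [CA], so N(f^c) vanishes on the sphere;
    apply [normal_val_zero] to f^c. *)
Lemma conj_zero a b I : CA S b -> b <> 0 -> SA S I -> a + I ** b = 0 ->
  exists2 K, SA S K & cj a + K ** cj b = 0.
Proof.
move=> Cb b0 sI aI.
have -> : a = - (I ** b) by vlin.
apply: normal_val_zero; [exact: CA_aconj|by rewrite aconj_eq0|by exists I|].
move=> J _; rewrite normal_conj_zero // aassoc_rot.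
by rewrite aassocCr CA_assoc // oppr0 amul0r.
Qed.

(** This pins down the zero of f^c. With s^-1 = m s^c, the left side is - (K s^-1) s. *)
Lemma conj_zero_eq s I K : CA S s -> s <> 0 -> K ** cj s = - (cj s ** I) ->
  (ainv S s ** I) ** s = - K.
Proof.
move=> Cs s0 KI; have [n [m [cn cm nm bc cb]]] := CA_norm s Cs s0.
have mn : m ** n = one by rewrite -(proj2 cn).
have sq : s ** (m ** cj s) = one by rewrite acenterCA // bc.
have qs : (m ** cj s) ** s = one by rewrite acenterA // cb.
rewrite (ainv_unique _ _ sq qs) (acenterA m) //.
have -> : cj s ** I = - (K ** cj s) by rewrite KI opprK.
by rewrite amulNr -acenterCA // amulNl amulVK.
Qed.
End Alternative.

(** * Slice functions and their zeros on a sphere *)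

Section Slice.
Context {R : realType} {A : vectType R} (S : altStarAlg A).
Local Notation "x ** y" := (amul S x y) (at level 40, left associativity).
Local Notation one := (aone S).
Local Notation cj := (aconj S).
Local Notation point a b I := (a *: one + b *: I).
Implicit Types (a b : R) (I J K x y : A) (D : set (R * R)) (F : R * R -> A * A).

Lemma scale_one_inj a b : a *: one = b *: one -> a = b.
Proof.
move=> /eqP; rewrite -subr_eq0 -scalerBl scaler_eq0 (negPf (aone_neq0 S)) orbF.
by rewrite subr_eq0 => /eqP.
Qed.

Lemma aconj_point a b J : SA S J -> cj (point a b J) = point a b (- J).
Proof. by move=> sJ; rewrite !(conjE S) (SA_conj S J). Qed.

Lemma are_point a b J : SA S J -> are S (point a b J) = a *: one.
Proof.
move=> sJ; rewrite /are /atr aconj_point // scalerN addrACA subrr addr0.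
by rewrite -scalerDl scalerA; congr (_ *: _); field.
Qed.

Lemma aim_point a b J : SA S J -> aim S (point a b J) = b *: J.
Proof. by move=> sJ; rewrite /aim are_point // addrC addKr. Qed.

(** Real parts give a = a'; squaring imaginary parts gives b^2 = b'^2. Only a common change of sign
    remains, or a real point. *)
Lemma point_inj a b J a' b' J' : SA S J -> SA S J' ->
  point a b J = point a' b' J' ->
  a = a' /\ (b = 0 /\ b' = 0 \/
             b != 0 /\ (b' = b /\ J' = J \/ b' = - b /\ J' = - J)).
Proof.
move=> sJ sJ' e.
have ea : a = a' by apply: scale_one_inj; rewrite -(are_point a b J) // e are_point.
have eb : b *: J = b' *: J' by rewrite -(aim_point a b J) // e aim_point.
split=> //.
have : b ^+ 2 = b' ^+ 2.
  apply: scale_one_inj; apply: oppr_inj.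
  have := congr1 (fun u => u ** u) eb.
  by rewrite !(mulE S) !SA_sqr // !scalerN !scalerA.
have [-> /eqP|b0] := eqVneq b 0.
  by rewrite expr0n eq_sym sqrf_eq0 => /eqP; left.
move=> /eqP; rewrite eqf_sqr => /orP[]/eqP bb'; right; split=> //.
  left; split=> //; apply: (scalerI b0); rewrite eb bb' //.
right; split; first by rewrite bb' opprK.
by apply: (scalerI b0); rewrite scalerN eb bb' scaleNr.
Qed.

Lemma stem_real D F a : is_stem D F -> D (a, 0) -> (F (a, 0)).2 = 0.
Proof.
move=> sF Da; have := sF a 0 Da; rewrite oppr0.
case: (F (a, 0)) => u v [/= e]; have h : v = - v by [].
by clear e; vlin.
Qed.

Lemma stem_conj_stem D F : is_stem D F -> is_stem D (stem_conj S F).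
Proof. by move=> sF a b Dab; rewrite /stem_conj (sF a b Dab) /= aconjN. Qed.

Lemma stem_normal_stem D F : is_stem D F -> is_stem D (stem_normal S F).
Proof.
move=> sF a b Dab; rewrite /stem_normal /stem_mul /stem_conj (sF a b Dab) /=.
by rewrite aconjN !(mulE S) !opprK opprD.
Qed.

(** [sliceI] chooses some decomposition of the point. The stem condition absorbs a common sign
    change of b and J, and at real points the second component vanishes. *)
Lemma sliceI_point D F a b J : is_stem D F -> D (a, b) -> SA S J ->
  sliceI S D F (point a b J) = (F (a, b)).1 + J ** (F (a, b)).2.
Proof.
move=> sF Dab sJ; rewrite /sliceI; case: xgetP => [v _|]; last first.
  by move=> /(_ ((F (a, b)).1 + J ** (F (a, b)).2)); case; exists a, b, J.
case=> a' [b' [J' [Dab' [sJ' [e ->]]]]].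
have [-> [[b0 b'0]|[b0 [[-> ->]//|[eb ->]]]]] := point_inj _ _ _ _ _ _ sJ sJ' e.
  have [<- _] := point_inj _ _ _ _ _ _ sJ sJ' e.
  move: Dab Dab'; have [<- _] := point_inj _ _ _ _ _ _ sJ sJ' e.
  by rewrite b0 b'0 => Dab _; rewrite (stem_real _ _ _ sF Dab) !amul0r.
have [ea _] := point_inj _ _ _ _ _ _ sJ sJ' e.
by rewrite -ea eb (sF a b Dab) /= amulNl amulNr opprK.
Qed.

Section Sphere.
Context (D : set (R * R)) (a b : R) (J : A).
Context (Dab : D (a, b)) (sJ : SA S J).
Local Notation Sx := (sphere S (point a b J)).

Lemma spherePoint y : Sx y <-> exists2 I, SA S I & y = point a b I.
Proof.
split=> [[a' [b' [J' [I [sJ' [sI [e ->]]]]]]]|[I sI ->]]; last first.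
  by exists a, b, J, I.
have [<- [[-> ->]|[_ [[-> _]|[-> _]]]]] := point_inj _ _ _ _ _ _ sJ sJ' e.
- by exists I; rewrite ?scale0r.
- by exists I.
- by exists (- I); [exact: SA_opp|rewrite scalerN scaleNr].
Qed.

Context (F : R * R -> A * A).
Context (sF : is_stem D F).
Local Notation V := (VZ S D (sliceI S D F)).
Local Notation u := (F (a, b)).1.
Local Notation v := (F (a, b)).2.

Lemma VZ_point I : SA S I -> V (point a b I) <-> u + I ** v = 0.
Proof.
move=> sI; rewrite /VZ /= sliceI_point //; split=> [[]//|h]; split=> //.
by exists a, b, I.
Qed.

Lemma sphere_sub_VZ : Sx `<=` V <-> forall I, SA S I -> u + I ** v = 0.
Proof.
split=> [h I sI|h y /spherePoint[I sI ->]]; apply/VZ_point => //; last exact: h.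
by apply: h; apply/spherePoint; exists I.
Qed.

Lemma sphere_meet_VZ y :
  (Sx `&` V) y <-> exists I, [/\ SA S I, y = point a b I & u + I ** v = 0].
Proof.
split=> [[/spherePoint[I sI ->] /VZ_point h]|[I [sI -> h]]].
  by exists I; split=> //; apply: h.
by split; [apply/spherePoint; exists I|apply/VZ_point].
Qed.

Lemma sphere_disj_VZ :
  Sx `&` V = set0 <-> forall I, SA S I -> u + I ** v <> 0.
Proof.
split=> [h I sI e|h]; last first.
  by rewrite -subset0 => y /sphere_meet_VZ[I [sI _ /h]]; apply.
have : (Sx `&` V) (point a b I) by apply/sphere_meet_VZ; exists I.
by rewrite h.
Qed.

Lemma sph_val_point : sph_val S (sliceI S D F) (point a b J) = u.
Proof.
rewrite /sph_val aconj_point // !sliceI_point //; last exact: SA_opp.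
by rewrite amulNl; vlin.
Qed.

(** The inverse of b J is - b^-1 J, and J (J v) = - v by alternativity. *)
Lemma sph_der_point : b != 0 ->
  sph_der S (sliceI S D F) (point a b J) = b^-1 *: v.
Proof.
move=> b0; rewrite /sph_der aim_point // aconj_point //.
rewrite !sliceI_point //; last exact: SA_opp.
have -> : ainv S (b *: J) = - (b^-1 *: J).
  by apply: ainv_unique; rewrite !(mulE S) SA_sqr // scalerN scalerN opprK
    scalerA ?mulfV ?mulVf // scale1r.
have -> : u + J ** v - (u + - J ** v) = 2 *: (J ** v) by rewrite amulNl; vlin.
rewrite !(mulE S) SA_mulK // !scalerN opprK !scalerA.
by congr (_ *: _); field.
Qed.
End Sphere.

(* [y = alpha + beta I] is a zero of [f], whose stem function takes the value
   [u + i beta s] at [alpha + i beta]; thus [s] is the spherical derivative. *)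
Lemma zero_normal D F a b J I s : is_stem D F -> D (a, b) -> b != 0 ->
  SA S J -> SA S I -> (F (a, b)).2 = b *: s ->
  (F (a, b)).1 + I ** (F (a, b)).2 = 0 ->
  let Sx := sphere S (point a b J) in
  let Nf := sliceI S D (stem_normal S F) in
  let Nfc := sliceI S D (stem_normal S (stem_conj S F)) in
  let y := point a b I in
  [/\ VZ S D Nfc (cj y),
      aassoc S s (cj s) y = 0 <-> Sx `<=` VZ S D Nfc,
      aassoc S s (cj s) y = 0 <-> VZ S D Nf y &
      aassoc S s (cj s) y = 0 ->
        (Sx `<=` VZ S D Nf <-> acomm S (anrm S s) y = 0)].
Proof.
move=> sF Dab b0 sJ sI ev z Sx Nf Nfc y.
set u := (F (a, b)).1 in z; set v := (F (a, b)).2 in ev z.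
have sN := stem_normal_stem _ _ sF.
have sC := stem_normal_stem _ _ (stem_conj_stem _ _ sF).
have eu : u = - (I ** v) by vlin.
have vN K : (stem_normal S F (a, b)).1 + K ** (stem_normal S F (a, b)).2 =
    (K - I) ** acomm S (v ** cj v) I - (K ** aassoc S (cj v) I v) *+ 2.
  by rewrite -normal_zero // -eu.
have vC K : (stem_normal S (stem_conj S F) (a, b)).1 +
    K ** (stem_normal S (stem_conj S F) (a, b)).2 =
    (I + K) ** aassoc S (cj v) I v.
  by rewrite -normal_conj_zero // -eu.
(* The real part of y drops out of the associator, so (v, v^c, I) = b^2 (s, s^c, I) = b (s, s^c, y).
   The same scaling works for the commutator below. *)
have eE : aassoc S (cj v) I v = b *: aassoc S s (cj s) y.
  rewrite aassoc_rot aassoc_rot ev /y /aassoc /assoc_of (aconjZ S) !(mulE S).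
  by apply: scalar_ext => phi; rewrite !(linearB, linearD, linearZ) /=; ring.
have ec : acomm S (v ** cj v) I = b *: acomm S (anrm S s) y.
  rewrite ev /y /acomm /anrm (aconjZ S) !(mulE S).
  by apply: scalar_ext => phi; rewrite !(linearB, linearD, linearZ) /=; ring.
have iE : aassoc S s (cj s) y = 0 <-> aassoc S (cj v) I v = 0.
  rewrite eE; split=> [->|/eqP]; first by rewrite scaler0.
  by rewrite scaler_eq0 (negPf b0) => /eqP.
have ic : acomm S (anrm S s) y = 0 <-> acomm S (v ** cj v) I = 0.
  rewrite ec; split=> [->|/eqP]; first by rewrite scaler0.
  by rewrite scaler_eq0 (negPf b0) => /eqP.
rewrite (propext iE) (propext ic); set E := aassoc S (cj v) I v in vN vC *.
set C := acomm S (v ** cj v) I in vN *.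
clear eu eE ec iE ic; clearbody E C.
have INI : I + - I = 0 by rewrite subrr.
split.
- rewrite /y aconj_point //; apply/VZ_point; rewrite ?vC ?INI ?amul0l //.
  exact: SA_opp.
- split=> [e|/(sphere_sub_VZ _ _ _ _ Dab sJ _ sC) h].
    by apply/sphere_sub_VZ => // K sK; rewrite vC e amul0r.
  (* At K = I the value of N(f^c) is 2 I E. *)
  apply: (SA_mul_eq0 S I) => //; apply: double_eq0.
  by rewrite -amulDl' -vC; apply: h.
- split=> [e|/(VZ_point _ _ _ Dab _ sN _ sI)].
    by apply/VZ_point => //; rewrite vN e subrr amul0l amul0r mul0rn subrr.
  (* At K = I the commutator term disappears, leaving - 2 I E. *)
  rewrite vN subrr amul0l sub0r mulr2n => /eqP; rewrite oppr_eq0 => /eqP h.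
  by apply: (SA_mul_eq0 S I) => //; apply: double_eq0.
- move=> e; split=> [/(sphere_sub_VZ _ _ _ _ Dab sJ _ sN) h|h].
    (* With E = 0, the value at K = - I is - 2 I C. *)
    have {h} := h _ (SA_opp S _ sI).
    rewrite vN e amul0r mul0rn subr0 !(mulE S) => h.
    by apply: (SA_mul_eq0 S I) => //; vlin.
  by apply/sphere_sub_VZ => // K sK; rewrite vN e h !amul0r mul0rn subrr.
Qed.

(** Serves both the case f'_s = 0 and the real points, where [stem_real] supplies the hypothesis. *)
Lemma stem_const_values F z I : (F z).2 = 0 ->
  [/\ (F z).1 + I ** (F z).2 = (F z).1,
      (stem_conj S F z).1 + I ** (stem_conj S F z).2 = cj (F z).1,
      (stem_normal S F z).1 + I ** (stem_normal S F z).2 = anrm S (F z).1 &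
      (stem_normal S (stem_conj S F) z).1
        + I ** (stem_normal S (stem_conj S F) z).2 = anrm S (cj (F z).1)].
Proof.
by move=> h; rewrite /anrm /= h !(aconj0, amul0l, amul0r, addr0, subr0).
Qed.
End Slice.

(** * Case analysis on the spherical derivative *)

Theorem theorem4p1 (R : realType) (A : vectType R) (S : altStarAlg A)
  (D : set (R * R)) (F : R * R -> A * A) :
  (exists J : A, SA S J) ->
  (exists z : R * R, D z) ->
  (forall a b : R, D (a, b) -> D (a, - b)) ->
  is_stem D F ->
  let mul := amul S in
  let cj := aconj S in
  let f := sliceI S D F in
  let fc := sliceI S D (stem_conj S F) in
  let Nf := sliceI S D (stem_normal S F) in
  let Nfc := sliceI S D (stem_normal S (stem_conj S F)) in
  let Om := Omega S D in
  (forall x : A, Om x -> ~ isReal S x ->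
     let Sx := sphere S x in
     let fs := sph_der S f x in
     let f0 := sph_val S f x in
     (* (1) *)
     (fs = 0 ->
        (Sx `<=` VZ S D f /\ Sx `<=` VZ S D fc /\
         Sx `<=` VZ S D Nf /\ Sx `<=` VZ S D Nfc)
        \/
        (Sx `&` VZ S D f = set0 /\ Sx `&` VZ S D fc = set0 /\
         (~ (asingular S /\ (null_nz S f0 \/ null_nz S (cj f0))) ->
            Sx `&` VZ S D Nf = set0 /\ Sx `&` VZ S D Nfc = set0)))
     /\
     (* (2) *)
     (right_zero_divisor S fs ->
        ((exists y, (Sx `&` VZ S D f) y) /\
         forall y, (Sx `&` VZ S D f) y ->
           (forall y', (Sx `&` VZ S D f) y' <->
                       (Sx y' /\ mul (aim S y' - aim S y) fs = 0)) /\
           ~ VZ S D f (cj y) /\ VZ S D Nfc (cj y) /\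
           (aassoc S fs (cj fs) y = 0 <-> Sx `<=` VZ S D Nfc) /\
           (aassoc S fs (cj fs) y = 0 <-> VZ S D Nf y) /\
           (aassoc S fs (cj fs) y = 0 ->
              (Sx `<=` VZ S D Nf <-> acomm S (anrm S fs) y = 0)))
        \/
        Sx `&` VZ S D f = set0)
     /\
     (* (3) *)
     (fs <> 0 -> ~ right_zero_divisor S fs ->
        (exists y, (Sx `&` VZ S D f) y /\
           (forall y', (Sx `&` VZ S D f) y' -> y' = y) /\
           VZ S D Nfc (cj y) /\
           (ainvertible S fs -> y = are S x - mul f0 (ainv S fs)) /\
           (aassoc S fs (cj fs) y = 0 <-> Sx `<=` VZ S D Nfc) /\
           (aassoc S fs (cj fs) y = 0 <-> VZ S D Nf y) /\
           (aassoc S fs (cj fs) y = 0 ->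
              (Sx `<=` VZ S D Nf <-> acomm S (anrm S fs) y = 0)) /\
           (CA S fs /\ fs <> 0 ->
              Sx `<=` VZ S D Nf /\ Sx `<=` VZ S D Nfc /\
              Sx `&` VZ S D fc = [set mul (mul (ainv S fs) (cj y)) fs]))
        \/
        (Sx `&` VZ S D f = set0 /\
         (CA S fs /\ fs <> 0 ->
            Sx `&` VZ S D fc = set0 /\
            ~ (Sx `<=` VZ S D Nf /\ Sx `<=` VZ S D Nfc) /\
            ((CA S f0 /\ f0 <> 0) \/ acompatible S ->
               ~ Sx `<=` VZ S D Nf /\ ~ Sx `<=` VZ S D Nfc)))))
  /\
  (forall x : A, Om x -> isReal S x ->
     (VZ S D f x /\ VZ S D fc x /\ VZ S D Nf x /\ VZ S D Nfc x)
     \/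
     (~ VZ S D f x /\ ~ VZ S D fc x /\
      (~ (asingular S /\ (null_nz S (f x) \/ null_nz S (cj (f x)))) ->
         ~ VZ S D Nf x /\ ~ VZ S D Nfc x))).
Proof.
move=> SAne _ _ sF mul cj f fc Nf Nfc Om.
have sC := stem_conj_stem S _ _ sF.
have sN := stem_normal_stem S _ _ sF.
have sM := stem_normal_stem S _ _ sC.
split=> x [a [b [J [Dab [sJ ->]]]]]; last first.
  case=> r er.
  have b0 : b = 0.
    (* The imaginary part b J of a real point is 0, and J is nonzero because its square is -1. *)
    have := aim_point S a b J sJ; rewrite er -[r *: _]addr0 -(scale0r J).
    rewrite aim_point // scale0r => /esym/eqP; rewrite scaler_eq0.
    move=> /orP[/eqP//|/eqP J0].
    have := SA_sqr S J sJ; rewrite J0 amul0r => /esym/eqP.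
    by rewrite oppr_eq0 (negPf (aone_neq0 S)).
  rewrite b0 in Dab *.
  have [z1 z2 z3 z4] := stem_const_values S F (a, 0) J (stem_real _ _ _ sF Dab).
  rewrite !(propext (VZ_point S D a 0 Dab _ _ J sJ)) // z1 z2 z3 z4.
  rewrite /f sliceI_point // z1.
  set u := (F (a, 0)).1.
  have [->|u0] := eqVneq u 0; first by left; rewrite /anrm !(aconj0, amul0l).
  have cu0 : cj u != 0 by apply/eqP; rewrite /cj aconj_eq0; apply/eqP.
  right; split; [exact/eqP|split; [exact/eqP|]] => ns; split=> n0; apply: ns.
    by split; [exists u|left].
  by split; [exists (cj u)|right].
move=> nr Sx fs f0.
have b0 : b != 0.
  by apply/eqP => b0; apply: nr; exists a; rewrite b0 scale0r addr0.
have e0 : f0 = (F (a, b)).1 by apply: sph_val_point.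
have es : (F (a, b)).2 = b *: fs.
  by rewrite /fs /f sph_der_point // scalerA mulfV // scale1r.
have ex : are S (a *: aone S + b *: J) = a *: aone S by apply: are_point.
clearbody fs f0; subst f0.
have subP G sG := sphere_sub_VZ S D a b J Dab sJ G sG.
have meetP G sG := sphere_meet_VZ S D a b J Dab sJ G sG.
have disjP G sG := sphere_disj_VZ S D a b J Dab sJ G sG.
have zeroP I : SA S I -> (F (a, b)).1 + amul S I (F (a, b)).2 = 0 -> _ :=
  zero_normal S D F a b J I fs sF Dab b0 sJ ^~ es.
set u := (F (a, b)).1 in zeroP *; set v := (F (a, b)).2 in es zeroP *.
have v0 : fs <> 0 -> v <> 0.
  by move=> h /eqP; rewrite es scaler_eq0 (negPf b0) => /eqP.
split; [|split].
- move=> fs0; have hv : v = 0 by rewrite es fs0 scaler0.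
  have val I := stem_const_values S F (a, b) I hv.
  have [u0|u0] := eqVneq u 0.
    left; split; [|split; [|split]]; apply/subP => // I _; have [z1 z2 z3 z4] := val I;
      by rewrite ?z1 ?z2 ?z3 ?z4 -/u u0 /anrm ?aconj0 ?amul0l.
  have cu0 : cj u != 0 by apply/eqP; rewrite /cj aconj_eq0; apply/eqP.
  right; split; [|split].
  + by apply/disjP => // I _; have [-> _ _ _] := val I; apply/eqP.
  + by apply/disjP => // I _; have [_ -> _ _] := val I; apply/eqP.
  + move=> ns; split; apply/disjP => // I _; have [_ _ z3 z4] := val I.
      by rewrite z3 => n0; apply: ns; split; [exists u|left].
    by rewrite z4 => n0; apply: ns; split; [exists (cj u)|right].
- move=> [/eqP fs0 _]; have [[y Vy]|nV] := pselect (exists y, (Sx `&` VZ S D f) y); last first.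
    by right; rewrite -subset0 => y Vy; apply: nV; exists y.
  left; split; first by exists y.
  move=> {Vy}y /(meetP _ sF) [I [sI -> z]].
  have [q1 q2 q3 q4] := zeroP I sI z.
  have z' : u = - amul S I v by apply/eqP; rewrite -addr_eq0 z.
  split; last split=> //.
    (* As f(y) = 0, the value f(y') is (I' - I) v = (im(y') - im(y)) f'_s. *)
    move=> y'; split.
      move=> Vy'; split; first by case: Vy'.
      have /(meetP _ sF) [I' [sI' -> /=]] := Vy'; rewrite -/u -/v z' es => e.
      by rewrite !aim_point // /mul !(mulE S) -e !(mulE S) addrC.
    case=> /(spherePoint S a b J sJ) [I' sI' ->]; rewrite !aim_point // => e.
    apply/meetP => //; exists I'; split=> //; rewrite -/u -/v z' es -e /mul.
    by rewrite !(mulE S) addrC.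
  (* A zero at y^c as well would give 2 I v = 0, hence v = 0. *)
  rewrite /cj aconj_point // => /(VZ_point S D a b Dab F sF _ (SA_opp S I sI)).
  rewrite -/u -/v z' amulNl -opprD => /eqP; rewrite oppr_eq0 => /eqP/double_eq0.
  by move=> /(SA_mul_eq0 S I v sI); apply: v0.
- move=> fs0 nzd.
  have Cv : CA S fs -> CA S v by rewrite es; apply: CA_scale.
  have [[y Vy]|nV] := pselect (exists y, (Sx `&` VZ S D f) y); last first.
    have nz I : SA S I -> u + amul S I v <> 0.
      move=> sI z; apply: nV; exists (a *: aone S + b *: I).
      by apply/meetP => //; exists I.
    right; split; first by apply/disjP.
    case=> /Cv {}Cv _.
    (* A zero of f^c would yield one of f, by [conj_zero] applied to the conjugates. *)
    have nzc K : SA S K -> cj u + amul S K (cj v) <> 0.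
      move=> sK z.
      have cv0 : cj v <> 0 by rewrite /cj aconj_eq0; apply: v0.
      have [I sI] := conj_zero S _ _ K (CA_aconj S _ Cv) cv0 sK z.
      by rewrite /cj !aconjK; apply: nz.
    have nN : ~ (Sx `<=` VZ S D Nf).
      move=> /(subP _ sN) h.
      by have [I sI] := normal_val_zero S u v Cv (v0 fs0) SAne h; apply: nz.
    have nM : ~ (Sx `<=` VZ S D Nfc).
      move=> /(subP _ sM) h.
      have cv0 : cj v <> 0 by rewrite /cj aconj_eq0; apply: v0.
      by have [I sI] := normal_val_zero S _ _ (CA_aconj S _ Cv) cv0 SAne h; apply: nzc.
    by split; [apply/disjP|split=> // -[]].
  left; exists y; split=> //.
  move: Vy => /(meetP _ sF) [I [sI -> z]].
  have [q1 q2 q3 q4] := zeroP I sI z.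
  have z' : u = - amul S I v by apply/eqP; rewrite -addr_eq0 z.
  split; [|split=> //; split; [|split=> //; split=> //; split=> //]].
  + move=> y' /(meetP _ sF) [I' [sI' -> /=]]; rewrite -/u -/v z' es => e.
    congr (_ + _ *: _); apply/eqP; rewrite -subr_eq0; apply/negPn/negP => d0.
    (* A second zero makes I' - I a nonzero left annihilator of f'_s. *)
    apply: nzd; split; first exact/eqP.
    exists (I' - I); split=> //; apply: (scalerI b0); rewrite scaler0 -e.
    by rewrite !(mulE S) addrC -scalerN -scalerDr.
  (* Since u = - (beta I) f'_s, right cancellation gives - u f'_s^-1 = beta I. *)
  + case=> t [st ts]; rewrite ex /mul (ainv_unique S _ _ st ts) z' es.
    by rewrite !(mulE S) (amulVK S _ _ _ st ts) opprK.
  + case=> Cs _.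
    have E0 : aassoc S fs (cj fs) (a *: aone S + b *: I) = 0.
      by rewrite -(aassoc_rot S _ fs) aassocCr CA_assoc // oppr0.
    have cen : acomm S (anrm S fs) (a *: aone S + b *: I) = 0.
      by case: Cs => [//|[[_ h] _]]; rewrite /acomm h subrr.
    split; [exact/q4|split; first exact/q2].
    (* Any zero of f^c on the sphere equals the displayed conjugate of y^c, which gives uniqueness;
       existence comes from [conj_zero]. *)
    have key K : SA S K -> cj u + amul S K (cj v) = 0 ->
        mul (mul (ainv S fs) (cj (a *: aone S + b *: I))) fs = a *: aone S + b *: K.
      move=> sK; rewrite z' es /cj aconj_point // !(conjE S) (SA_conj S I) // => e.
      have KI : amul S K (aconj S fs) = - amul S (aconj S fs) I.
        apply: (scalerI b0); rewrite scalerN; apply/eqP.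
        by rewrite -addr_eq0 addrC -e !(mulE S) opprK.
      have := conj_zero_eq S fs I K Cs fs0 KI.
      have [t [st ts]] := CA_invertible S fs Cs fs0.
      rewrite (ainv_unique S _ _ st ts) /mul => k.
      by rewrite !(mulE S) k ts opprK.
    have [K sK zK] := conj_zero S u v I (Cv Cs) (v0 fs0) sI z.
    rewrite (key K sK zK); apply/seteqP; split=> y'.
      move=> /(meetP _ sC) [K' [sK' -> zK']] /=.
      by rewrite -(key K' sK' zK') (key K sK zK).
    by move=> /= ->; apply/meetP => //; exists K.
Qed.
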